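(* Let $D$ be a delta-matroid with ground set $E$. Then $$Q_{(1,\sqrt{y/x},0)}\big(D;\sqrt{xy}\big)=\big(\sqrt{y/x}\big)^{r(E)}\,R\big(D;x+1,y,1/\sqrt{xy}\big),$$ where $r(E)=r_{D_{\min}}(E)$.
   Context: A set system is a pair $D=(E,\mathcal{F})$ with $E$ a finite set and $\mathcal{F}$ a collection of subsets of $E$ (feasible sets). A delta-matroid is a set system with $\mathcal{F}\ne\emptyset$ such that for all $X,Y\in\mathcal{F}$ and $u\in X\bigtriangleup Y$ there is $v\in X\bigtriangleup Y$ (possibly $v=u$) with $X\bigtriangleup\{u,v\}\in\mathcal{F}$, where $\bigtriangleup$ is symmetric difference. For $A\subseteq E$ the twist is $D*A=(E,\{A\bigtriangleup X:X\in\mathcal{F}\})$. For $e\in E$, $D+e=(E,\mathcal{F}\bigtriangleup\{F\cup\{e\}:F\in\mathcal{F},e\notin F\})$, and $D+\{e_1,\dots,e_n\}=D+e_1+\cdots+e_n$ (loop complementation; order immaterial). The dual pivot is $D\bar{*}A=((D*A)+A)*A$. For a set system with at least one feasible set, $d_D$ is the minimum cardinality of a feasible set (for a delta-matroid this is $r(D_{\min})$). $D_{\min}$ and $D_{\max}$ are the matroids on $E$ whose bases are the feasible sets of $D$ of minimum, respectively maximum, cardinality; $r_{D_{\min}}$ is the rank function of $D_{\min}$. Deletion: $e$ is a coloop (loop) of $D$ if it is in every (no) feasible set. If $e$ is not a coloop, $D\setminus e=(E-e,\{F:F\in\mathcal{F},F\subseteq E-e\})$; if $e$ is a coloop, $D\setminus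 e=D/e=(E-e,\{F-e:F\in\mathcal{F}\})$. $D|A:=D\setminus(E-A)$, deleting elements one at a time (order immaterial). $\mathcal{P}_3(E)$ is the set of ordered partitions $(A,B,C)$ of $E$ into three, possibly empty, blocks. For constant weights $(\alpha,\beta,\gamma)$ in a commutative ring with unity, the transition polynomial is $$Q_{(\alpha,\beta,\gamma)}(D;t)=\sum_{(A,B,C)\in\mathcal{P}_3(E)}\alpha^{|A|}\beta^{|B|}\gamma^{|C|}\,t^{d_{D*B\bar{*}C}},$$ with $0^0=1$. The Bollob\'as--Riordan polynomial of a delta-matroid is $$R(D;x,y,z)=\sum_{A\subseteq E}(x-1)^{r_{D_{\min}}(E)-r_{D_{\min}}(A)}\,y^{|A|-r_{D_{\min}}(A)}\,z^{r((D|A)_{\max})-r((D|A)_{\min})}.$$ Square roots are formal and chosen compatibly: $\sqrt{xy}=\sqrt{x}\sqrt{y}$ and $\sqrt{y/x}=\sqrt{y}/\sqrt{x}$. *)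

(* Defs.v *)
From mathcomp Require Import all_boot all_order all_algebra.

Set Implicit Arguments.
Unset Strict Implicit.
Unset Printing Implicit Defensive.

Import GRing.Theory.

Definition symdiff (T : finType) (A B : {set T}) : {set T} :=
  (A :\: B) :|: (B :\: A).

(* The ground set is a subset of an ambient finType, rather than the type
   itself, so that deletion does not change the type.  That the feasible sets
   are subsets of the ground set is required in [is_set_system]. *)
Record set_system (T : finType) := SetSystem {
  ground : {set T};
  feas : {set {set T}}
}.

Definition is_set_system (T : finType) (D : set_system T) : Prop :=
  forall F : {set T}, F \in feas D -> F \subset ground D.

Definition is_delta_matroid (T : finType) (D : set_system T) : Prop :=
  [/\ is_set_system D,
      feas D != set0
    & forall X Y : {set T}, X \in feas D -> Y \in feas D ->
      forall u : T, u \in symdiff X Y ->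
      exists2 v : T, v \in symdiff X Y & symdiff X [set u; v] \in feas D].

Definition twist (T : finType) (D : set_system T) (A : {set T}) :
    set_system T :=
  SetSystem (ground D) [set symdiff A X | X in feas D].

Definition loopc1 (T : finType) (D : set_system T) (e : T) : set_system T :=
  SetSystem (ground D)
    (symdiff (feas D) [set F :|: [set e] | F in feas D & e \notin F]).

(* The elements are treated in the order of [enum A]; the result does not
   depend on the order. *)
Definition loopc (T : finType) (D : set_system T) (A : {set T}) :
    set_system T :=
  foldl (@loopc1 T) D (enum A).

Definition dual_pivot (T : finType) (D : set_system T) (A : {set T}) :
    set_system T :=
  twist (loopc (twist D A) A) A.

(* A feasible set has at most [#|ground D|] elements, so the default value of
   the iterated minimum only matters when there is no feasible set. *)
Definition min_card (T : finType) (D : set_system T) : nat :=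
  \big[minn/#|ground D|]_(F in feas D) #|F|.

Definition max_card (T : finType) (D : set_system T) : nat :=
  \max_(F in feas D) #|F|.

(* A matroid is given by its ground set and its bases, hence is itself a set
   system. *)
Definition lower_matroid (T : finType) (D : set_system T) : set_system T :=
  SetSystem (ground D) [set F in feas D | #|F| == min_card D].

Definition upper_matroid (T : finType) (D : set_system T) : set_system T :=
  SetSystem (ground D) [set F in feas D | #|F| == max_card D].

Definition indep (T : finType) (M : set_system T) (I : {set T}) : bool :=
  [exists B in feas M, I \subset B].

Definition rank_fun (T : finType) (M : set_system T) (A : {set T}) : nat :=
  \max_(I : {set T} | indep M I && (I \subset A)) #|I|.

Definition rank (T : finType) (M : set_system T) : nat :=
  rank_fun M (ground M).

Definition coloop (T : finType) (D : set_system T) (e : T) : bool :=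
  [forall F in feas D, e \in F].

Definition delete1 (T : finType) (D : set_system T) (e : T) : set_system T :=
  SetSystem (ground D :\ e)
    (if coloop D e then [set F :\ e | F in feas D]
     else [set F in feas D | F \subset ground D :\ e]).

(* As for [loopc], the order of deletion is immaterial for a delta-matroid. *)
Definition delete (T : finType) (D : set_system T) (A : {set T}) :
    set_system T :=
  foldl (@delete1 T) D (enum A).

Definition restrict (T : finType) (D : set_system T) (A : {set T}) :
    set_system T :=
  delete D (ground D :\: A).

Definition ordered_partition3 (T : finType) (E A B C : {set T}) : bool :=
  [&& A :|: B :|: C == E, [disjoint A & B], [disjoint A & C]
    & [disjoint B & C]].

Local Open Scope ring_scope.

Definition transition_poly (T : finType) (K : comPzRingType)
    (alpha beta gamma : K) (D : set_system T) (t : K) : K :=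
  \sum_(A : {set T}) \sum_(B : {set T})
    \sum_(C : {set T} | ordered_partition3 (ground D) A B C)
      alpha ^+ #|A| * beta ^+ #|B| * gamma ^+ #|C|
      * t ^+ min_card (dual_pivot (twist D B) C).

(* The truncated subtractions in the exponents are exact when [D] is a
   delta-matroid and [A \subset ground D]. *)
Definition bollobas_riordan (T : finType) (K : comPzRingType)
    (D : set_system T) (x y z : K) : K :=
  let r := rank_fun (lower_matroid D) in
  \sum_(A : {set T} | A \subset ground D)
    (x - 1) ^+ (r (ground D) - r A)%N
    * y ^+ (#|A| - r A)%N
    * z ^+ (rank (upper_matroid (restrict D A))
            - rank (lower_matroid (restrict D A)))%N.

(* Main.v *)
Require Import Defs.
From mathcomp Require Import all_boot all_order all_algebra.
From mathcomp Require Import zify ring.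

(** The weight [0] kills every term of the transition polynomial whose third
    block is not empty, so the left-hand side is a sum over [A \subset E] of
    [(sy / sx) ^+ #|A| * (sx * sy) ^+ d], where [d] is the least cardinality of
    [symdiff A F] over feasible [F].  Both sides are then sums over the subsets
    of [E], and they agree term by term: comparing exponents of [sx] and [sy],
    everything reduces to
        d = r(E) + |A| - 2 r(A) - (r((D|A)_max) - r((D|A)_min)).

    Two facts about a delta-matroid give this identity.  First, every feasible
    set contains a feasible set of least cardinality ([min_feasible_sub]).
    Secondly, deleting [X] leaves the traces [F :\: X] of the feasible sets [F]
    that meet [X] in as few elements as possible ([feas_delete]).

    Let [X = E :\: A], and let [m] be the least value of [#|F :&: X|].  By the
    first fact some feasible [F0] has least cardinality and also [#|F0 :&: X|
    = m]; so [r(E) = #|F0|], and [r(A)] and [r((D|A)_min)] are both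
    [#|F0 :&: A|].  The twist [D * A] is again a delta-matroid and twisting by
    [A] does not change the part of a set in [X]; so the first fact also gives a
    feasible [F1] with [#|symdiff A F1| = d] and [#|F1 :&: X| = m].  As
    [#|symdiff A F| = #|F :&: X| + #|A| - #|F :&: A|], this [F1] has the largest
    intersection with [A] among the sets that meet [X] in [m] elements, so that
    [r((D|A)_max) = #|F1 :&: A|] and [d = m + #|A| - #|F1 :&: A|].  The identity
    follows. *)

Set Implicit Arguments.
Unset Strict Implicit.
Unset Printing Implicit Defensive.

Import GRing.Theory.

(** * Symmetric differences and the exchange axiom *)

Section Families.

Variable T : finType.
Implicit Types (A B F G X Y S : {set T}) (FF : {set {set T}}) (e u v : T).

Lemma in_symdiff A B x : (x \in symdiff A B) = (x \in A) (+) (x \in B).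
Proof. by rewrite !inE; case: (x \in A); case: (x \in B). Qed.

Lemma symdiffA : associative (@symdiff T).
Proof. by move=> A B F; apply/setP=> x; rewrite !in_symdiff addbA. Qed.

Lemma symdiff0 A : symdiff set0 A = A.
Proof. by apply/setP=> x; rewrite in_symdiff inE. Qed.

Lemma symdiff_cancel A B F : symdiff (symdiff A B) (symdiff A F) = symdiff B F.
Proof.
apply/setP=> x; rewrite !in_symdiff.
by case: (x \in A); case: (x \in B); case: (x \in F).
Qed.

Definition exchange FF : Prop :=
  forall X Y, X \in FF -> Y \in FF -> forall u, u \in symdiff X Y ->
  exists2 v, v \in symdiff X Y & symdiff X [set u; v] \in FF.

Lemma exchange_twist FF A :
  exchange FF -> exchange [set symdiff A X | X in FF].
Proof.
move=> exFF _ _ /imsetP[X XF ->] /imsetP[Y YF ->] u; rewrite symdiff_cancel.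
by case/(exFF _ _ XF YF)=> v vXY XvF; exists v; rewrite // -symdiffA imset_f.
Qed.

(** Among the feasible sets of least cardinality, one that has the fewest
    elements outside [Y] has none at all: exchanging an element of [F :\: Y]
    must bring in an element of [Y], because [F] cannot get smaller. *)
Lemma min_feasible_sub FF Y : exchange FF -> Y \in FF ->
  exists F, [/\ F \in FF, F \subset Y & forall G, G \in FF -> #|F| <= #|G|].
Proof.
move=> exFF YF.
case: (arg_minnP (P := fun F => F \in FF) (fun F => #|F|) YF) => M MF minM.
have MP : (M \in FF) && (#|M| == #|M|) by rewrite MF eqxx.
case: (arg_minnP (P := fun F => (F \in FF) && (#|F| == #|M|))
        (fun F => #|F :\: Y|) MP) => F /andP[FF_F /eqP cF] minF.
exists F; split=> // [|G GF]; last by rewrite cF minM.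
apply/subsetPn=> -[u uF uY].
have uFY : u \in symdiff F Y by rewrite in_symdiff uF (negPf uY).
have [v vFY F'F] := exFF _ _ FF_F YF _ uFY.
have [vF | vF] := boolP (v \in F).
  suff: #|symdiff F [set u; v]| < #|F| by rewrite ltnNge cF minM.
  apply/proper_card/properP; split.
    apply/subsetP=> z; rewrite in_symdiff !inE.
    by case: eqVneq => [-> | _]; [rewrite uF | case: eqVneq => [-> | _]];
      rewrite ?vF //= addbF.
  by exists u; rewrite // in_symdiff !inE eqxx uF.
have vu : v != u by apply: contraNneq vF => ->.
have vY : v \in Y by move: vFY; rewrite in_symdiff (negPf vF).
have F'E : symdiff F [set u; v] = v |: (F :\ u).
  apply/setP=> z; rewrite in_symdiff !inE.
  case: (eqVneq z u) => [-> | _]; first by rewrite uF eq_sym (negPf vu).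
  by case: eqVneq => [-> | _] /=; rewrite ?(negPf vF) ?addbF.
have cF' : #|symdiff F [set u; v]| = #|F|.
  by rewrite F'E cardsU1 !inE (negPf vF) andbF (cardsD1 u F) uF.
have := minF _ (introT andP (conj F'F (introT eqP (etrans cF' cF)))).
rewrite leqNgt => /negP; apply; apply/proper_card/properP; split.
  rewrite F'E; apply/subsetP=> z; rewrite !inE.
  by case: eqVneq => [-> | _] /=; [rewrite vY | case/and3P=> -> _ ->].
by exists u; rewrite ?F'E !inE ?uF ?uY // eqxx eq_sym (negPf vu).
Qed.

(** * Deletion *)

Definition least_meet FF X :=
  [set F in FF | [forall G in FF, #|F :&: X| <= #|G :&: X|]].

Lemma least_meetP FF X F :
  reflect (F \in FF /\ forall G, G \in FF -> #|F :&: X| <= #|G :&: X|)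
          (F \in least_meet FF X).
Proof. by rewrite inE; apply: (iffP andP) => -[? /forall_inP]. Qed.

Lemma least_meet_neq0 FF X : FF != set0 -> exists F, F \in least_meet FF X.
Proof.
case/set0Pn=> F0 F0F.
case: (arg_minnP (P := fun F => F \in FF) (fun F => #|F :&: X|) F0F)
  => F FF_F minF.
by exists F; apply/least_meetP.
Qed.

(** The feasible sets after deletion of all of [X] at once. *)
Definition traces FF X := [set F :\: X | F in least_meet FF X].

Lemma cardI1 F e : #|F :&: [set e]| = (e \in F).
Proof.
case: (boolP (e \in F)) => eF; first by rewrite (setIidPr _) ?cards1 // sub1set.
by apply/eqP; rewrite cards_eq0 setI_eq0 disjoint_sym disjoints1.
Qed.

Lemma least_meet1P FF F e :
  reflect (F \in FF /\ forall G, G \in FF -> e \in F -> e \in G)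
          (F \in least_meet FF [set e]).
Proof.
apply: (iffP (least_meetP _ _ _)) => -[FF_F minF]; split=> // G /minF;
  by rewrite ?cardI1; case: (e \in F) => [|//]; case: (e \in G) => // /(_ isT).
Qed.

Lemma least_meet1_mem FF F G e :
    F \in least_meet FF [set e] -> G \in least_meet FF [set e] ->
  (e \in F) = (e \in G).
Proof.
case/least_meet1P=> FF_F minF /least_meet1P[GF minG].
by apply/idP/idP; [apply: minF | apply: minG].
Qed.

Lemma exchange_traces1 FF e : exchange FF -> exchange (traces FF [set e]).
Proof.
move=> exFF _ _ /imsetP[F Fm ->] /imsetP[G Gm ->] u uFG.
have eFG := least_meet1_mem Fm Gm.
have symE : symdiff (F :\ e) (G :\ e) = symdiff F G.
  apply/setP=> z; rewrite !in_symdiff !inE.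
  by case: eqVneq => //= ->; rewrite eFG addbb.
have /least_meet1P[FF_F minF] := Fm; have /least_meet1P[GF _] := Gm.
rewrite symE in uFG *; have [v vFG F'F] := exFF _ _ FF_F GF _ uFG.
have neq w : w \in symdiff F G -> (e == w) = false.
  by case: eqVneq => // <-; rewrite in_symdiff eFG addbb.
exists v => //; apply/imsetP; exists (symdiff F [set u; v]).
  by apply/least_meet1P; split=> // H HF; rewrite in_symdiff !inE !neq // addbF;
    apply: minF.
apply/setP=> z; rewrite !(inE, in_symdiff).
by case: (eqVneq z e) => //= ->; rewrite !neq.
Qed.

Lemma card_meetU1 F S e : e \notin S ->
  #|F :&: (e |: S)| = (e \in F) + #|F :&: S|.
Proof.
move=> eS; rewrite setIUr cardsU cardI1.
suff ->: F :&: [set e] :&: (F :&: S) = set0 by rewrite cards0 subn0.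
by apply/setP=> z; rewrite !inE; case: eqVneq => [-> | _];
  rewrite ?(negPf eS) !andbF.
Qed.

Lemma meetD1 F S e : e \notin S -> (F :\ e) :&: S = F :&: S.
Proof.
move=> eS; apply/setP=> z; rewrite !inE.
by case: eqVneq => //= ->; rewrite (negPf eS) andbF.
Qed.

(** The hypothesis on [F] says that [e] lies in [F] but not in every feasible
    set; exchanging [e] with a feasible set that avoids it removes [e] from [F]
    at the cost of bringing in at most one element [v]. *)
Lemma exchange_out FF F e : exchange FF -> F \in FF ->
    F \notin least_meet FF [set e] ->
  e \in F /\ exists v, let F' := symdiff F [set e; v] in
    [/\ F' \in FF, F' \in least_meet FF [set e] & e \notin F'].
Proof.
move=> exFF FF_F; rewrite inE FF_F => /forall_inPn[G GF].
rewrite !cardI1 -ltnNge; case eF: (e \in F); case eG: (e \in G) => // _.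
have eFG : e \in symdiff F G by rewrite in_symdiff eF eG.
split=> //; have [v vFG F'F] := exFF _ _ FF_F GF _ eFG; exists v.
have eF' : e \notin symdiff F [set e; v] by rewrite in_symdiff eF !inE eqxx.
by split=> //; apply/least_meet1P; split=> // H _; rewrite (negPf eF').
Qed.

Lemma card_symdiff_out F S e v : e \notin S ->
  #|symdiff F [set e; v] :&: S| <= (v \in S :\: F) + #|F :&: S|.
Proof.
move=> eS.
have: symdiff F [set e; v] :&: S \subset (F :&: S) :|: ((S :\: F) :&: [set v]).
  apply/subsetP=> z; rewrite !(inE, in_symdiff).
  case: (eqVneq z e) => [->|_]; first by rewrite (negPf eS) andbF.
  by case: (z \in F); case: (z \in S); case: eqVneq.
move=> /subset_leq_card /leq_trans; apply.
by apply: leq_trans (leq_card_setU _ _) _; rewrite cardI1 addnC.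
Qed.

(** Only the traces agree, not the families of sets that leave them: a set [F]
    with [e \in F] may meet [e |: S] in as few elements as possible although
    [e] is not a coloop.  Exchanging [e] then brings in an element of [S], so
    that the trace stays the same. *)
Lemma traces_traces1 FF S e : exchange FF -> e \notin S ->
  traces (traces FF [set e]) S = traces FF (e |: S).
Proof.
move=> exFF eS.
have traceI F : (F :\ e) :\: S = F :\: (e |: S) by rewrite setDDl.
have lexi F : F \in least_meet FF (e |: S) -> F \in least_meet FF [set e] ->
    F :\ e \in least_meet (traces FF [set e]) S.
  move=> /least_meetP[FF_F minF] Fm; apply/least_meetP; split.
    exact: imset_f.
  move=> _ /imsetP[G Gm ->]; rewrite !meetD1 //.
  have /least_meet1P[/minF + _] := Gm.
  by rewrite !card_meetU1 // (least_meet1_mem Fm Gm) leq_add2l.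
apply/setP=> H; apply/imsetP/imsetP => -[].
  move=> _ /least_meetP[/imsetP[F Fm ->] minF] ->; exists F; last exact: traceI.
  have /least_meet1P[FF_F min1] := Fm; apply/least_meetP; split=> // G GF.
  rewrite !card_meetU1 //.
  have minS G' : G' \in least_meet FF [set e] -> #|F :&: S| <= #|G' :&: S|.
    by move=> G'm; have := minF _ (imset_f _ G'm); rewrite !meetD1.
  have [Gm | Gm] := boolP (G \in least_meet FF [set e]).
    by rewrite (least_meet1_mem Fm Gm) leq_add2l minS.
  (* Losing [e] makes up for the element [v] that [G'] may gain in [S]. *)
  have [eG [v [G'F G'm eG']]] := exchange_out exFF GF Gm.
  rewrite (least_meet1_mem Fm G'm) (negPf eG') eG add0n.
  apply: leq_trans (minS _ G'm) (leq_trans (card_symdiff_out _ _ eS) _).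
  by rewrite leq_add2r leq_b1.
move=> F Fm ->; have /least_meetP[FF_F minF] := Fm.
have [F1 | F1] := boolP (F \in least_meet FF [set e]).
  by exists (F :\ e); rewrite ?lexi ?traceI.
have [eF [v [F'F F'm eF']]] := exchange_out exFF FF_F F1.
set F' := symdiff _ _ in F'F F'm eF'.
have bound := card_symdiff_out F v eS; rewrite -/F' in bound.
have := minF _ F'F; rewrite !card_meetU1 // eF (negPf eF') add0n => low.
(* [F'] lost [e], so by minimality of [F] it must have gained [v] in [S]. *)
have vS : v \in S :\: F by move: bound low; case: (v \in _) => //; lia.
have F'l : F' \in least_meet FF (e |: S).
  apply/least_meetP; split=> // G /minF; apply: leq_trans.
  rewrite !card_meetU1 // eF (negPf eF'); move: bound; rewrite vS; lia.
exists (F' :\ e); first exact: lexi.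
rewrite traceI; apply/setP=> z; rewrite !(inE, in_symdiff).
case: (eqVneq z e) => //= _; case: (eqVneq z v) => [-> | _]; last first.
  by case: (z \in F).
by move: vS; rewrite inE => /andP[_ ->].
Qed.

End Families.

Section Systems.

Variable T : finType.
Implicit Types (A F X : {set T}) (D M : set_system T) (e : T).

Lemma feas_delete1 D e : is_set_system D -> feas D != set0 ->
  feas (delete1 D e) = traces (feas D) [set e].
Proof.
move=> sysD /set0Pn[F0 F0D]; rewrite /delete1 /=.
have [/forall_inP col | ncol] := boolP (coloop D e).
  rewrite /traces;   suff ->: least_meet (feas D) [set e] = feas D by [].
  apply/setP=> F; apply/least_meet1P/idP => [[] // | FD].
  by split=> // G GD _; apply: col.
have /forall_inPn[G GD eG] := ncol.
apply/setP=> F; rewrite inE subsetD1; apply/andP/imsetP.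
  case=> FD /andP[_ eF]; exists F; last first.
    by apply/setP=> z; rewrite !inE; case: eqVneq => // ->; rewrite (negPf eF).
  by apply/least_meet1P; split=> // H _; rewrite (negPf eF).
case=> H /least_meet1P[HD minH] ->.
have eH : e \notin H by apply: contra eG; apply: minH.
have ->: H :\ e = H.
  by apply/setP=> z; rewrite !inE; case: eqVneq => // ->; rewrite (negPf eH).
by rewrite HD sysD.
Qed.

Lemma delta_matroid_delete1 D e :
  is_delta_matroid D -> is_delta_matroid (delete1 D e).
Proof.
case=> sysD D0 exD; have fE := feas_delete1 e sysD D0; split; rewrite ?fE.
- move=> F; rewrite fE => /imsetP[H /least_meet1P[HD _] ->].
  by rewrite setSD // sysD.
- have [F Fm] := least_meet_neq0 [set e] D0.
  by apply/set0Pn; exists (F :\ e); apply: imset_f.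
- exact: exchange_traces1.
Qed.

Lemma delta_matroid_delete D X :
  is_delta_matroid D -> is_delta_matroid (delete D X).
Proof.
rewrite /delete; elim: (enum X) D => //= e s IHs D dmD.
exact/IHs/delta_matroid_delete1.
Qed.

Lemma feas_delete D X :
  is_delta_matroid D -> feas (delete D X) = traces (feas D) X.
Proof.
have {2}->: X = [set z in enum X] by apply/setP=> z; rewrite inE mem_enum.
rewrite /delete; elim: (enum X) (enum_uniq X) D => /= [_ D _ | e s IHs].
  have ->: [set z in [::]] = set0 :> {set T} by apply/setP=> z; rewrite !inE.
  apply/setP=> F; apply/idP/imsetP=> [FD | [H /least_meetP[HD _] ->]].
    exists F; rewrite ?setD0 //; apply/least_meetP; split=> // G _.
    by rewrite !setI0.
  by rewrite setD0.
case/andP=> es us D dmD; rewrite IHs //; last exact: delta_matroid_delete1.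
have [sysD D0 exD] := dmD.
rewrite feas_delete1 // traces_traces1 // ?inE //.
by congr traces; apply/setP=> z; rewrite !inE.
Qed.

(** * Ranks *)

Lemma min_card_eq D F : F \in feas D -> #|F| <= #|ground D| ->
  (forall G, G \in feas D -> #|F| <= #|G|) -> min_card D = #|F|.
Proof.
move=> FD FE minF; apply/eqP; rewrite eqn_leq; apply/andP; split.
  rewrite /min_card -minEnat -leEnat; exact: Order.TotalTheory.bigmin_le_cond.
by apply: (big_ind (fun n => #|F| <= n)) => // m n; rewrite leq_min => ->.
Qed.

Lemma max_card_eq D F : F \in feas D ->
  (forall G, G \in feas D -> #|G| <= #|F|) -> Defs.max_card D = #|F|.
Proof.
move=> FD maxF; apply/eqP; rewrite eqn_leq leq_bigmax_cond // andbT.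
exact/bigmax_leqP.
Qed.

Lemma rank_fun_eq M A F : F \in feas M ->
    (forall G, G \in feas M -> #|G :&: A| <= #|F :&: A|) ->
  rank_fun M A = #|F :&: A|.
Proof.
move=> FM maxF; apply/eqP; rewrite eqn_leq; apply/andP; split.
  apply/bigmax_leqP=> I /andP[/exists_inP[B BM IB] IA].
  by apply: leq_trans (maxF _ BM); apply: subset_leq_card; apply/subsetIP.
apply: leq_bigmax_cond; rewrite subsetIr andbT.
by apply/exists_inP; exists F; rewrite ?subsetIl.
Qed.

Lemma rank_uniform M F : is_set_system M -> F \in feas M ->
  (forall G, G \in feas M -> #|G| = #|F|) -> rank M = #|F|.
Proof.
move=> sysM FM eqF; rewrite /rank (rank_fun_eq (F := F)) // => [|G GM].
  by rewrite (setIidPl (sysM _ FM)).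
by rewrite !(setIidPl (sysM _ _)) // eqF.
Qed.

Lemma rank_lower D F : is_set_system D -> F \in feas D ->
  (forall G, G \in feas D -> #|F| <= #|G|) -> rank (lower_matroid D) = #|F|.
Proof.
move=> sysD FD minF.
have minE := min_card_eq FD (subset_leq_card (sysD _ FD)) minF.
apply: rank_uniform => [G||G] /=; rewrite inE ?minE ?FD ?eqxx //.
  by case/andP=> /sysD.
by case/andP=> _ /eqP.
Qed.

Lemma rank_upper D F : is_set_system D -> F \in feas D ->
  (forall G, G \in feas D -> #|G| <= #|F|) -> rank (upper_matroid D) = #|F|.
Proof.
move=> sysD FD maxF; have maxE := max_card_eq FD maxF.
apply: rank_uniform => [G||G] /=; rewrite inE ?maxE ?FD ?eqxx //.
  by case/andP=> /sysD.
by case/andP=> _ /eqP.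
Qed.

(** The exponents of both sides in subtraction-free form.  Here [k] is the rank
    of [A] in [D_min] and [m] the least number of elements of a feasible set
    outside [A]; [k + w] is the largest number of elements of [A] in a feasible
    set that has only [m] outside, and [j] the number of elements of [A] that
    such a set misses. *)
Lemma delta_matroid_exponents D A : is_delta_matroid D -> A \subset ground D ->
  exists k m w j : nat,
  [/\ #|A| = k + w + j, rank_fun (lower_matroid D) (ground D) = k + m,
      rank_fun (lower_matroid D) A = k, min_card (twist D A) = m + j
    & rank (upper_matroid (restrict D A)) = k + w
      /\ rank (lower_matroid (restrict D A)) = k].
Proof.
move=> dmD AE; have [sysD D0 exD] := dmD.
set X := ground D :\: A.
have meetX F : F \in feas D -> F :&: X = F :\: A.
  by move=> /sysD FE; rewrite setIDA (setIidPl FE).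
have splitE F : F \in feas D -> #|F| = #|F :&: A| + #|F :&: X|.
  by move=> FD; rewrite meetX // cardsID.
have traceE F : F \in feas D -> F :\: X = F :&: A.
  move=> /sysD /subsetP FE; apply/setP=> z; rewrite !inE.
  by case zF: (z \in F); rewrite ?andbF // (FE _ zF) !andbT negbK.
have twistE F : F \in feas D ->
    #|symdiff A F| + #|F :&: A| = #|F :&: X| + #|A|.
  move=> FD; rewrite /symdiff cardsU meetX //.
  have ->: (A :\: F) :&: (F :\: A) = set0.
    by apply/setP=> z; rewrite !inE; case: (z \in A); case: (z \in F).
  by rewrite cards0 subn0 -(cardsID F A) (setIC A F); lia.
have [Y Ym] := least_meet_neq0 X D0; have /least_meetP[YD minY] := Ym.
have meet_le (F G : {set T}) : F \subset G -> #|F :&: X| <= #|G :&: X|.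
  by move=> FG; rewrite subset_leq_card // setSI.
have [F0 [F0D F0Y minF0]] := min_feasible_sub exD YD.
have F0X : #|F0 :&: X| = #|Y :&: X|.
  by apply/eqP; rewrite eqn_leq meet_le ?minY.
have [_ [/imsetP[F1 F1D ->] F1Y minF1]] :=
  min_feasible_sub (exchange_twist (A := A) exD) (imset_f (symdiff A) YD).
(* Twisting by [A] leaves the part in [X] unchanged, so that [F1 :&: X] is
   contained in [Y :&: X] because [symdiff A F1] is contained in [symdiff A Y]. *)
have twistX F : symdiff A F :&: X = F :&: X.
  apply/setP=> z; rewrite !(inE, in_symdiff).
  by case: (z \in A); rewrite ?andbF.
have F1X : #|F1 :&: X| = #|Y :&: X|.
  by apply/eqP; rewrite eqn_leq minY // -(twistX F1) -(twistX Y) meet_le.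
have lowE : min_card D = #|F0|.
  by apply: min_card_eq => //; rewrite subset_leq_card ?sysD.
have [sysR _ _] := delta_matroid_delete X dmD.
have feasR F : F \in feas D -> #|F :&: X| = #|Y :&: X| ->
    F :&: A \in feas (delete D X).
  move=> FD FX; rewrite feas_delete // -traceE //; apply: imset_f.
  by apply/least_meetP; split=> // G; rewrite FX; apply: minY.
have feasRP H : H \in feas (delete D X) -> exists F,
    [/\ F \in feas D, #|F :&: X| = #|Y :&: X| & H = F :&: A].
  rewrite feas_delete // => /imsetP[F /least_meetP[FD minF] ->]; exists F.
  by rewrite traceE //; split=> //; apply/eqP; rewrite eqn_leq minF ?minY.
exists #|F0 :&: A|, #|Y :&: X|, (#|F1 :&: A| - #|F0 :&: A|),
  (#|A| - #|F1 :&: A|).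
have F1A : #|F1 :&: A| <= #|A| by rewrite subset_leq_card ?subsetIr.
have F01 : #|F0 :&: A| <= #|F1 :&: A|.
  have := minF1 _ (imset_f (symdiff A) F0D).
  by move: (twistE _ F0D) (twistE _ F1D); lia.
split; first by lia.
- have [sysM F0M] : is_set_system (lower_matroid D) /\
      F0 \in feas (lower_matroid D).
    by split=> [F|]; rewrite inE ?F0D ?lowE ?eqxx //; case/andP=> /sysD.
  rewrite -F0X -splitE //; apply: (@rank_lower D) => //.
- apply: rank_fun_eq => [|G]; rewrite inE ?F0D ?lowE ?eqxx //.
  case/andP=> GD /eqP cG.
  by have := minY _ GD; move: (splitE _ GD) (splitE _ F0D); lia.
- rewrite (@min_card_eq _ (symdiff A F1)) ?imset_f //.
    by move: (twistE _ F1D); lia.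
  by rewrite subset_leq_card // !(subUset, subDset) /=
    !subsetU ?AE ?sysD ?orbT.
- rewrite /restrict -/X; split.
    rewrite (@rank_upper _ (F1 :&: A)) ?feasR //; first by lia.
    move=> _ /feasRP[F [FD FX ->]].
    have := minF1 _ (imset_f (symdiff A) FD).
    by move: (twistE _ FD) (twistE _ F1D); lia.
  apply: rank_lower => //; first exact: feasR.
  move=> _ /feasRP[F [FD FX ->]]; have := minF0 _ FD.
  by move: (splitE _ FD) (splitE _ F0D); lia.
Qed.

End Systems.

(** * The two polynomials *)

Local Open Scope ring_scope.

Lemma min_card_dual_pivot0 (T : finType) (D : set_system T) :
  min_card (dual_pivot D set0) = min_card D.
Proof.
have twist0 (D' : set_system T) : twist D' set0 = D'.
  case: D' => E FF; congr SetSystem => /=.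
  by rewrite (eq_imset (g := id)) ?imset_id // => A; apply: symdiff0.
by rewrite /dual_pivot /loopc enum_set0 /= !twist0.
Qed.

Lemma transition_poly_gamma0 (T : finType) (K : comPzRingType)
    (alpha beta t : K) (D : set_system T) :
  transition_poly alpha beta 0 D t =
  \sum_(B : {set T} | B \subset ground D)
    alpha ^+ #|ground D :\: B| * beta ^+ #|B| * t ^+ min_card (twist D B).
Proof.
rewrite /transition_poly exchange_big /= [RHS]big_mkcond /=.
apply: eq_bigr => B _.
have inner (A : {set T}) :
    \sum_(C | ordered_partition3 (ground D) A B C)
      alpha ^+ #|A| * beta ^+ #|B| * 0 ^+ #|C|
      * t ^+ min_card (dual_pivot (twist D B) C) =
    if (B \subset ground D) && (A == ground D :\: B) then
      alpha ^+ #|A| * beta ^+ #|B| * t ^+ min_card (twist D B) else 0.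
  have part0 : ordered_partition3 (ground D) A B set0 =
      (B \subset ground D) && (A == ground D :\: B).
    rewrite /ordered_partition3 setU0 -!setI_eq0 !setI0 eqxx !andbT.
    apply/andP/andP=> [[/eqP <- /eqP dAB] | [BE /eqP ->]].
      by rewrite subsetUr setDUl setDv setU0 (setDidPl _) // -setI_eq0 dAB.
    by rewrite setUC -{1}(setIidPr BE) setID setIDAC -setIDA setDv setI0.
  rewrite -part0 big_mkcond (bigD1 set0) //= big1 ?addr0.
    by rewrite cards0 expr0 mulr1 min_card_dual_pivot0.
  by move=> C C0; case: ifP; rewrite // expr0n cards_eq0 (negPf C0) mulr0 mul0r.
rewrite (eq_bigr _ (fun A _ => inner A)).
case: (B \subset ground D) => /=; last by rewrite big1.
by rewrite -big_mkcond big_pred1_eq.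
Qed.

(* [sx] and [sy] are the formal square roots of [x] and [y], so that
   sqrt(xy) is [sx * sy] and sqrt(y/x) is [sy / sx]. *)
Theorem proposition5p9 (T : finType) (D : set_system T) (K : comUnitRingType)
    (x y sx sy : K) (hD : is_delta_matroid D)
    (hx : x \is a GRing.unit) (hy : y \is a GRing.unit)
    (hsx : sx ^+ 2 = x) (hsy : sy ^+ 2 = y) :
  transition_poly 1 (sy / sx) 0 D (sx * sy) =
  (sy / sx) ^+ rank_fun (lower_matroid D) (ground D)
  * bollobas_riordan D (x + 1) y (1 / (sx * sy)).
Proof.
have ux : sx \is a GRing.unit by move: hx; rewrite -hsx unitrX_pos.
have uy : sy \is a GRing.unit by move: hy; rewrite -hsy unitrX_pos.
rewrite transition_poly_gamma0 /bollobas_riordan mulr_sumr.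
apply: eq_bigr => A AE; rewrite expr1n mul1r addrK.
have [k [m [w [j [cA rE rA dA [rU rL]]]]]] := delta_matroid_exponents hD AE.
rewrite rE rA rU rL dA cA !addKn -addnA addKn.
set p := sx * sy; set q := sy / sx.
have up : p \is a GRing.unit by rewrite unitrM ux.
have qx : q * x = p by rewrite -hsx expr2 mulrA divrK // mulrC.
have qp : q * p = y by rewrite /p mulrA divrK // -expr2.
rewrite div1r.
have yp : y * p^-1 = q by rewrite -qp mulrK.
clearbody p q.
have -> : q ^+ (k + (w + j)) * p ^+ (m + j)
    = q ^+ k * p ^+ m * q ^+ w * (q * p) ^+ j.
  by rewrite !exprD exprMn; ring.
have -> : q ^+ (k + m) * (x ^+ m * y ^+ (w + j) * p^-1 ^+ w)
    = q ^+ k * (q * x) ^+ m * (y * p^-1) ^+ w * y ^+ j.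
  by rewrite !exprD !exprMn; ring.
by rewrite qx qp yp.
Qed.
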